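(* Let $K\subseteq\mathbb{R}$ be a compact set, $m\ge 1$ a natural number, and $f_1,\ldots,f_m\colon K\to K$ be $m$ continuous functions. Then the following two conditions are equivalent: (a) for every $a_1a_2a_3\ldots\in\{1,2,\ldots,m\}^\omega$ we have $\lim_{n\to\infty}\mathrm{diam}\big(f_{a_1}\circ f_{a_2}\circ\ldots\circ f_{a_n}(K)\big)=0$; (b) there exists a continuous metric $d\colon K\times K\to[0,+\infty)$ such that $f_1,f_2,\ldots,f_m$ are all $d$-contracting. If $f_1,\ldots,f_m$ are non-decreasing, then these two conditions are equivalent to the following condition: (c) there exists a continuous metric $d\colon K\times K\to[0,+\infty)$ such that, first, $f_1,f_2,\ldots,f_m$ are all $d$-contracting, and second, for all $x,y,s,t\in K$ we have $x\le s\le t\le y\implies d(s,t)\le d(x,y)$.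
   Context: $\{1,\ldots,m\}^\omega$ is the set of infinite sequences with entries in $\{1,\ldots,m\}$. For $S\subseteq\mathbb{R}$, $\mathrm{diam}(S)=\sup_{x,y\in S}|x-y|$. A metric $d\colon K\times K\to[0,+\infty)$ is continuous if it is continuous as a function with respect to the standard (Euclidean) topology on $K\times K\subseteq\mathbb{R}^2$; likewise continuity of the $f_i$ is with respect to the standard topology on $K$. A function $h\colon K\to K$ is $d$-contracting if for all $x,y\in K$ with $x\ne y$ we have $d(h(x),h(y))<d(x,y)$. A function $f$ is non-decreasing if $x\le y\implies f(x)\le f(y)$ on its domain. *)

(* Defs.v *)
From mathcomp Require Import all_boot all_order all_algebra.
From mathcomp Require Import all_classical all_reals all_analysis.
Import Order.TTheory GRing.Theory Num.Theory.
Import numFieldNormedType.Exports.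

Set Implicit Arguments.
Unset Strict Implicit.
Unset Printing Implicit Defensive.

Local Open Scope classical_set_scope.
Local Open Scope ring_scope.

(* MathComp-Analysis' [sup] is 0 on the empty set and on unbounded sets; only
   subsets of a compact set are measured below, so [sup] is the true supremum,
   with the convention diam set0 = 0. *)
Definition diam (R : realType) (S : set R) : R :=
  sup [set `|p.1 - p.2| | p in S `*` S].

(* f_(a 0) \o f_(a 1) \o ... \o f_(a n.-1); the sequence a_1 a_2 ... is indexed
   from 0. *)
Fixpoint comp_prefix (T : Type) (m : nat) (f : 'I_m -> T -> T)
    (a : nat -> 'I_m) (n : nat) : T -> T :=
  if n is n'.+1 then comp_prefix f a n' \o f (a n') else id.

(* A function on K (or K * K) is represented by a total function whose values
   outside K (or K * K) are irrelevant. *)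
Record metric_on (R : realType) (K : set R) (d : R -> R -> R) : Prop := {
  metric_ge0 : forall x y, K x -> K y -> 0 <= d x y;
  metric_eq0 : forall x y, K x -> K y -> (d x y = 0 <-> x = y);
  metric_sym : forall x y, K x -> K y -> d x y = d y x;
  metric_triangle : forall x y z, K x -> K y -> K z ->
    d x z <= d x y + d y z }.

Definition continuous_metric_on (R : realType) (K : set R) (d : R -> R -> R) :=
  metric_on K d /\ {within K `*` K, continuous (fun p : R * R => d p.1 p.2)}.

Definition contracting_on (R : realType) (K : set R) (d : R -> R -> R)
    (h : R -> R) :=
  forall x y, K x -> K y -> x <> y -> d (h x) (h y) < d x y.

Definition order_compatible_on (R : realType) (K : set R) (d : R -> R -> R) :=
  forall x y s t, K x -> K y -> K s -> K t ->
    x <= s -> s <= t -> t <= y -> d s t <= d x y.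

(* Main.v *)
(** Condition (a) is equivalent to uniform shrinking, i.e. the maximal diameter
    of the images f_w(K) over all words w of length n tends to 0 (Koenig's
    lemma). If all maps contract d, then by compactness each of them decreases
    every distance at least e by some fixed r > 0, so that long compositions
    bring all distances below e. Conversely, with an increasing sequence of
    weights 1 = c_0 < c_1 < ... < 2, the metric
      d(x, y) = sup_(n, |w| = n) c_n |f_w(x) - f_w(y)|
    is contracted: passing from (x, y) to (f_i(x), f_i(y)) replaces w by w i, and
    the weight c_n of that term by c_n < c_(n+1). It is order compatible when
    the f_w are non-decreasing. *)
Require Import Defs.
From mathcomp Require Import all_boot all_order all_algebra.
From mathcomp Require Import all_classical all_reals all_analysis.
From mathcomp Require Import lra.
Import Order.TTheory GRing.Theory Num.Theory.
Import numFieldNormedType.Exports.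

Set Implicit Arguments.
Unset Strict Implicit.
Unset Printing Implicit Defensive.

Local Open Scope classical_set_scope.
Local Open Scope ring_scope.

(** * Continuity relative to a subset *)

(** Keeping [within B] on the target side lets properties that hold near [g x] only relative to [B]
    be pulled back along [g]. *)
Lemma cvg_within_set_fun (T U : topologicalType) (A : set T) (B : set U)
    (g : T -> U) (x : T) :
  {within A, continuous g} -> set_fun A B g -> A x ->
  g @ within A (nbhs x) --> within B (nbhs (g x)).
Proof.
move=> /subspace_continuousP gc gAB Ax P; rewrite /= /within /= => BP.
have /= := gc x Ax _ BP; rewrite /nbhs /= /within /=.
by apply: filterS => z gz Az; apply: gz => //; exact: gAB.
Qed.

Lemma within_continuous_prod_map (T1 T2 U1 U2 : topologicalType)
    (A : set T1) (B : set T2) (g : T1 -> U1) (h : T2 -> U2) :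
  {within A, continuous g} -> {within B, continuous h} ->
  {within A `*` B, continuous (fun p => (g p.1, h p.2))}.
Proof.
move=> /subspace_continuousP gc /subspace_continuousP hc.
apply/subspace_continuousP => -[x y] [/= Ax By]; apply: cvg_pair => /=.
- apply: cvg_comp (gc _ Ax).
  apply: (@cvg_within_set_fun _ _ (A `*` B) A fst (x, y)) => //.
  + by apply: continuous_subspaceT => -[? ?]; exact: cvg_fst.
  + by move=> ? [].
- apply: cvg_comp (hc _ By).
  apply: (@cvg_within_set_fun _ _ (A `*` B) B snd (x, y)) => //.
  + by apply: continuous_subspaceT => -[? ?]; exact: cvg_snd.
  + by move=> ? [].
Qed.

Lemma within_continuous_comp (T U V : topologicalType) (A : set T) (B : set U)
    (g : T -> U) (h : U -> V) :
  {within A, continuous g} -> {within B, continuous h} -> set_fun A B g ->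
  {within A, continuous (h \o g)}.
Proof.
move=> gc /subspace_continuousP hc gAB; apply/subspace_continuousP => x Ax.
by apply: cvg_comp (hc _ (gAB _ Ax)); exact: cvg_within_set_fun.
Qed.

(** * Bounds from compactness and finiteness *)

Lemma compact_pos_lbound (R : realType) (T : topologicalType) (A : set T)
    (u : T -> R) :
  compact A -> {within A, continuous u} -> (forall x, A x -> 0 < u x) ->
  exists2 e, 0 < e & forall x, A x -> e <= u x.
Proof.
move=> Ac uc u_gt0; have [->|/set0P A0] := eqVneq A set0; first by exists 1.
have [c /set_mem Acc cmin] := compact_EVT_min A0 Ac uc.
by exists (u c); [exact: u_gt0 | move=> x /mem_set; exact: cmin].
Qed.

Lemma compact_ubound (R : realType) (T : topologicalType) (A : set T)
    (u : T -> R) :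
  compact A -> {within A, continuous u} -> exists M, forall x, A x -> u x <= M.
Proof.
move=> Ac uc; have [->|/set0P A0] := eqVneq A set0; first by exists 0.
have [c _ cmax] := compact_EVT_max A0 Ac uc.
by exists (u c) => x /mem_set; exact: cmax.
Qed.

Lemma finite_pos_lbound (R : realType) (I : finType) (e : I -> R) :
  (forall i, 0 < e i) -> exists2 r, 0 < r & forall i, r <= e i.
Proof.
move=> e_gt0; exists (\big[Num.min/1]_i e i); last by move=> i; exact: bigmin_le.
by apply: lt_bigmin.
Qed.

(** The maximum [u] of [e - d x y] and [d x y - d (h x) (h y)] is continuous and positive on all of
    [K * K], and its lower bound serves as [r]. Taking a maximum avoids passing to the compact
    subset where [e <= d x y]. *)
Lemma contracting_gap (R : realType) (K : set R) (d : R -> R -> R) (h : R -> R)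
    (e : R) :
  compact K -> continuous_metric_on K d -> set_fun K K h ->
  {within K, continuous h} -> contracting_on K d h -> 0 < e ->
  exists2 r, 0 < r & forall x y, K x -> K y -> e <= d x y ->
    d (h x) (h y) <= d x y - r.
Proof.
move=> Kc [dm dc] hK hc hd e_gt0.
pose u := (fun p : R * R => e - d p.1 p.2) \max
          (fun p : R * R => d p.1 p.2 - d (h p.1) (h p.2)).
have dhc : {within K `*` K, continuous (fun p : R * R => d (h p.1) (h p.2))}.
  apply: (within_continuous_comp (within_continuous_prod_map hc hc) dc).
  by move=> [x y] [/= Kx Ky]; split; exact: hK.
have [|[x y] [/= Kx Ky]|r r_gt0 ur] :=
    compact_pos_lbound (u := u) (compact_setX Kc Kc).
- move=> p; apply: continuous_max; apply: cvgB => //.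
  + exact: cvg_cst.
  + exact: dc.
  + exact: dc.
  + exact: dhc.
- rewrite /u /= lt_max; case: (ltP (d x y) e) => [|dxy]; first by rewrite subr_gt0 => ->.
  rewrite !subr_gt0; apply/orP; right; apply: hd => // xy.
  by move: e_gt0; rewrite xy ((metric_eq0 dm Ky Ky).2 erefl) in dxy *; lra.
exists r => // x y Kx Ky edxy.
have := ur (x, y) (conj Kx Ky); rewrite /u /= le_max => /orP[]; lra.
Qed.

(** Same device: the maximum of [e - |x - y|] and [d x y] is positive on the compact set [K * K]. *)
Lemma small_dist_of_small_metric (R : realType) (K : set R) (d : R -> R -> R)
    (e : R) :
  compact K -> continuous_metric_on K d -> 0 < e ->
  exists2 r, 0 < r & forall x y, K x -> K y -> d x y < r -> `|x - y| <= e.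
Proof.
move=> Kc [dm dc] e_gt0.
pose u := (fun p : R * R => e - `|p.1 - p.2|) \max (fun p : R * R => d p.1 p.2).
have [|[x y] [/= Kx Ky]|r r_gt0 ur] :=
    compact_pos_lbound (u := u) (compact_setX Kc Kc).
- move=> p; apply: continuous_max; last exact: dc.
  apply: (@continuous_subspaceT _ _ _ (fun p : R * R => e - `|p.1 - p.2|)).
  move=> -[x y]; apply: cvgB; first exact: cvg_cst.
  by apply: cvg_norm; apply: cvgB; [exact: cvg_fst|exact: cvg_snd].
- rewrite /u /= lt_max subr_gt0; have [//|exy /=] := ltP.
  rewrite lt_neqAle (metric_ge0 dm)// andbT eq_sym; apply/eqP.
  move/(metric_eq0 dm Kx Ky) => xy; move: exy.
  by rewrite xy subrr normr0 leNgt e_gt0.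
exists r => // x y Kx Ky dxy.
by have := ur (x, y) (conj Kx Ky); rewrite /u /= le_max => /orP[]; lra.
Qed.

(** * Compositions along words *)

Lemma comp_prefix_fun (T : Type) (K : set T) (m : nat) (f : 'I_m -> T -> T)
    (a : nat -> 'I_m) (n : nat) :
  (forall i, set_fun K K (f i)) -> set_fun K K (comp_prefix f a n).
Proof. by move=> fK; elim: n => [//|n IHn] x Kx; exact/IHn/fK. Qed.

Lemma comp_prefixD (T : Type) (m : nat) (f : 'I_m -> T -> T) (a : nat -> 'I_m)
    (n k : nat) :
  comp_prefix f a (n + k) =
    comp_prefix f a n \o comp_prefix f (fun j => a (n + j)%N) k.
Proof.
elim: k => [|k IHk]; first by rewrite addn0.
by rewrite addnS /= IHk.
Qed.

Lemma eq_comp_prefix (T : Type) (m : nat) (f : 'I_m -> T -> T)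
    (a b : nat -> 'I_m) (n : nat) :
  (forall j, (j < n)%N -> a j = b j) -> comp_prefix f a n = comp_prefix f b n.
Proof.
elim: n => [//|n IHn] ab /=; rewrite ab// IHn// => j jn.
by apply: ab; exact: ltnW.
Qed.

(** * From a contracted metric to uniform shrinking *)

(** The link between the conditions: [N] is chosen before the sequence [a]. *)
Definition uniformly_shrinking (R : realType) (K : set R) (m : nat)
    (f : 'I_m -> R -> R) :=
  forall e, 0 < e -> exists N, forall n a x y, (N <= n)%N -> K x -> K y ->
    `|comp_prefix f a n x - comp_prefix f a n y| <= e.

Lemma contracting_uniformly_shrinking (R : realType) (K : set R) (m : nat)
    (f : 'I_m -> R -> R) (d : R -> R -> R) :
  compact K -> (forall i, set_fun K K (f i)) ->
  (forall i, {within K, continuous (f i)}) ->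
  continuous_metric_on K d -> (forall i, contracting_on K d (f i)) ->
  uniformly_shrinking K f.
Proof.
move=> Kc fK fc dcm fd e e_gt0.
have [r r_gt0 dr] := small_dist_of_small_metric Kc dcm e_gt0.
have /choice[s sP] i : exists s, 0 < s /\ forall x y, K x -> K y ->
    r <= d x y -> d (f i x) (f i y) <= d x y - s.
  by have [s] := contracting_gap Kc dcm (fK i) (fc i) (fd i) r_gt0; exists s.
have [t t_gt0 ts] := finite_pos_lbound (fun i => (sP i).1).
have [M dM] := compact_ubound (compact_setX Kc Kc) dcm.2.
have fd_le i x y : K x -> K y -> d (f i x) (f i y) <= d x y.
  move=> Kx Ky; have [->|/eqP xy] := eqVneq x y; last exact/ltW/fd.
  have [dm _] := dcm; rewrite (metric_eq0 dm (fK i _ Ky) (fK i _ Ky)).2//.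
  exact: (metric_ge0 dm).
(* As long as the final distance is at least [r], each of the [n] letters has cost at least [t]. *)
have dn n a x y : K x -> K y ->
    r <= d (comp_prefix f a n x) (comp_prefix f a n y) ->
    d (comp_prefix f a n x) (comp_prefix f a n y) <= d x y - n%:R * t.
  elim: n x y => [|n IHn] x y Kx Ky /=; first by rewrite mul0r subr0.
  (* [f (a n)] acts first. The induction hypothesis bounds the distance of its values below by [r],
     hence also [d x y], so the gap of [f (a n)] applies. *)
  move=> rd; have := IHn _ _ (fK (a n) _ Kx) (fK (a n) _ Ky) rd.
  have nt_ge0 : 0 <= n%:R * t by rewrite mulr_ge0// ltW.
  have := fd_le (a n) _ _ Kx Ky; have := ts (a n); rewrite -natr1 mulrDl mul1r.
  by have := (sP (a n)).2 _ _ Kx Ky; lra.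
(* Beyond this [N] the bound [d x y - n%:R * t] would be negative. *)
have [N MN] : exists N : nat, M < N%:R * t.
  exists (Num.truncn (M / t)).+1; rewrite -ltr_pdivrMr//.
  exact: truncnS_gt.
exists N => n a x y Nn Kx Ky; apply: dr; [exact: comp_prefix_fun..|].
rewrite ltNge; apply/negP => rd; have := dn n a x y Kx Ky rd.
have := dM (x, y) (conj Kx Ky) => /=.
have : N%:R * t <= n%:R * t by rewrite ler_pM2r// ler_nat.
by lra.
Qed.

(** * Diameters, and condition (a) as uniform shrinking *)

Lemma diam_ge0 (R : realType) (S : set R) : 0 <= diam S.
Proof.
rewrite /diam; set E := [set _ | _ in _].
have [supE|/sup_out->//] := pselect (has_sup E).
have [z Ez] := supE.1; have [p _ zE] := Ez.
by apply: le_trans (sup_upper_bound supE Ez); rewrite -zE.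
Qed.

Lemma diam_le (R : realType) (S : set R) (e : R) :
  0 <= e -> (forall x y, S x -> S y -> `|x - y| <= e) -> diam S <= e.
Proof.
move=> e_ge0 Se; rewrite /diam.
have [-> | /set0P/ge_sup] := eqVneq [set `|p.1 - p.2| | p in S `*` S] set0.
  by rewrite sup0.
by apply => _ [[x y] [/= Sx Sy] <-]; exact: Se.
Qed.

Lemma compact_dist_bounded (R : realType) (K : set R) :
  compact K -> exists M, forall x y, K x -> K y -> `|x - y| <= M.
Proof.
move=> Kc.
have [|M KM] := compact_ubound (u := fun p : R * R => `|p.1 - p.2|)
  (compact_setX Kc Kc).
  apply: continuous_subspaceT => -[x y].
  by apply: cvg_norm; apply: cvgB; [exact: cvg_fst|exact: cvg_snd].
by exists M => x y Kx Ky; exact: (KM (x, y)).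
Qed.

Lemma ler_dist_diam (R : realType) (K S : set R) (x y : R) :
  compact K -> S `<=` K -> S x -> S y -> `|x - y| <= diam S.
Proof.
move=> /compact_dist_bounded[M KM] SK Sx Sy; apply: ub_le_sup; last by exists (x, y).
by exists M => _ [[s t] [/= Ss St] <-]; apply: KM; exact: SK.
Qed.

Lemma uniformly_shrinking_diam (R : realType) (K : set R) (m : nat)
    (f : 'I_m -> R -> R) (a : nat -> 'I_m) :
  uniformly_shrinking K f ->
  diam (comp_prefix f a n @` K) @[n --> \oo] --> (0 : R).
Proof.
move=> fU; apply/cvgrPdist_le => e e_gt0; have [N fN] := fU _ e_gt0.
exists N => // n /= Nn; rewrite sub0r normrN ger0_norm ?diam_ge0//.
apply: diam_le => [|_ _ [x Kx <-] [y Ky <-]]; first exact: ltW.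
exact: fN.
Qed.

(* Koenig's lemma: if some [e] defeats uniformity, then a word [g] all of whose
   extension lengths contain an [e]-wide image can be prolonged by one letter
   keeping this property; iterating yields a sequence violating the diameter
   condition. *)
Lemma diam_uniformly_shrinking (R : realType) (K : set R) (m : nat)
    (f : 'I_m -> R -> R) :
  compact K -> (1 <= m)%N -> (forall i, set_fun K K (f i)) ->
  (forall a : nat -> 'I_m,
    diam (comp_prefix f a n @` K) @[n --> \oo] --> (0 : R)) ->
  uniformly_shrinking K f.
Proof.
move=> Kc m_ge1 fK fdiam e e_gt0; pose i0 := Ordinal m_ge1.
pose wide (g : R -> R) n := exists b x y, [/\ K x, K y &
  e < `|g (comp_prefix f b n x) - g (comp_prefix f b n y)|].
have wideW g n k : (n <= k)%N -> wide g k -> wide g n.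
  move=> /subnKC <- [b [x [y [Kx Ky]]]]; rewrite comp_prefixD => gxy.
  by exists b; do 2 eexists; split; [| |exact: gxy]; exact: comp_prefix_fun.
have wide_step g : (forall n, wide g n) ->
    exists i, forall n, wide (g \o f i) n.
  move=> gw; apply: contrapT => /forallNP ng.
  have /choice[k kP] i : exists k, ~ wide (g \o f i) k by exact/existsNP.

  (* A wide extension of [g] longer than every [k i] starts with some letter [b 0]; its remainder
     makes [g \o f (b 0)] wide at a length at least [k (b 0)]. *)
  have [b [x [y [Kx Ky]]]] := gw (\max_i k i).+1.
  rewrite -add1n comp_prefixD => gxy; apply: (kP (b 0%N)).
  apply: (wideW _ _ _ (leq_bigmax (b 0%N))).
  by exists (fun j => b j.+1), x, y.
have [//|/forallNP nN] := pselect (exists N, forall n a x y, (N <= n)%N ->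
  K x -> K y -> `|comp_prefix f a n x - comp_prefix f a n y| <= e).
have idw n : wide id n.
  apply: contrapT => nw; apply: (nN n) => k b x y nk Kx Ky.
  rewrite leNgt; apply/negP => exy; apply: nw; apply: (wideW _ _ _ nk).
  by exists b, x, y.
(* The letter is chosen for every [g], with [i0] as a default where [g] is not wide, so that the
   recursion needs no proof argument. *)
have /choice[step stepP] g : exists i, (forall n, wide g n) ->
    forall n, wide (g \o f i) n.
  have [/wide_step[i gi]|ngw] := pselect (forall n, wide g n); first by exists i.
  by exists i0.
pose g := fix g n := if n is n'.+1 then g n' \o f (step (g n')) else id.
have gw n : forall k, wide (g n) k.
  by elim: n => [|n IHn]; [exact: idw|exact: (stepP _ IHn)].
pose a n := step (g n).
have ga n : comp_prefix f a n = g n by elim: n => //= n ->.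
have /cvgrPdist_le fa := fdiam a.
have [N _ /(_ N (leqnn N))] := fa _ e_gt0.
rewrite /= sub0r normrN ger0_norm ?diam_ge0// => diam_e.
(* Extension length 0 says that the image of [K] under [g N] is itself wide. *)
have [b [x [y [/= Kx Ky gxy]]]] := gw N 0%N.
suff : `|g N x - g N y| <= e by rewrite leNgt gxy.
apply: le_trans diam_e; rewrite ga; apply: (ler_dist_diam Kc).
- by move=> _ [z Kz <-]; rewrite -ga; exact: comp_prefix_fun.
- by exists x.
- by exists y.
Qed.

(** * The increasing weights *)

Definition weight (R : realType) (n : nat) : R := 2 - n.+1%:R^-1.

Lemma weight_ge1 (R : realType) (n : nat) : 1 <= weight R n.
Proof.
have : n.+1%:R^-1 <= 1 :> R by rewrite invf_le1 ?ltr0n// ler1n.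
by rewrite /weight; move: (_^-1) => u; lra.
Qed.

Lemma weight_le2 (R : realType) (n : nat) : weight R n <= 2.
Proof. by rewrite /weight gerBl. Qed.

Lemma weight_ltS (R : realType) (n : nat) : weight R n < weight R n.+1.
Proof. by rewrite ltrD2l ltrN2 ltf_pV2 ?posrE ?ltr0n// ltr_nat. Qed.

(** Consecutive ratios tend to 1, so [q] has to depend on [N]; it is a maximum of finitely many
    ratios and the starting value 1/2. *)
Lemma weight_ratio (R : realType) (N : nat) :
  exists q : R, [/\ 0 < q, q < 1 &
    forall n, (n < N)%N -> weight R n <= q * weight R n.+1].
Proof.
have w_gt0 n : 0 < weight R n by exact: lt_le_trans (weight_ge1 R n).
elim: N => [|N [q [q_gt0 q_lt1 qP]]]; first by exists (1 / 2); split => //; lra.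
exists (Num.max q (weight R N / weight R N.+1)); split.
- by rewrite lt_max q_gt0.
- by rewrite gt_max q_lt1 ltr_pdivrMr// mul1r weight_ltS.
- move=> n; rewrite ltnS leq_eqVlt => /predU1P[->|/qP nq].
    by rewrite -ler_pdivrMr// le_max lexx orbT.
  by apply: (le_trans nq); rewrite ler_pM2r// le_max lexx.
Qed.

(** * The weighted supremum metric *)

(** A word is encoded as a length together with an infinite sequence, of which only that many first
    entries matter. *)
Definition orbit_dist (R : realType) (m : nat) (f : 'I_m -> R -> R) (x y : R)
    : R :=
  sup [set weight R p.1 * `|comp_prefix f p.2 p.1 x - comp_prefix f p.2 p.1 y|
      | p in [set: nat * (nat -> 'I_m)]].

Lemma le_orbit_dist (R : realType) (K : set R) (m : nat) (f : 'I_m -> R -> R)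
    (n : nat) (a : nat -> 'I_m) (x y : R) :
  compact K -> (forall i, set_fun K K (f i)) -> K x -> K y ->
  weight R n * `|comp_prefix f a n x - comp_prefix f a n y| <= orbit_dist f x y.
Proof.
move=> /compact_dist_bounded[M KM] fK Kx Ky; apply: ub_le_sup; last first.
  by exists (n, a).
(* Weights are at most 2 and distances in [K] at most [M]. *)
exists (2 * M) => _ [[k b] _ <-] /=; apply: ler_pM => //.
- exact: le_trans (weight_ge1 R k).
- exact: weight_le2.
- by apply: KM; exact: comp_prefix_fun.
Qed.

Lemma orbit_dist_le (R : realType) (m : nat) (f : 'I_m -> R -> R) (x y z : R) :
  (1 <= m)%N ->
  (forall n a,
    weight R n * `|comp_prefix f a n x - comp_prefix f a n y| <= z) ->
  orbit_dist f x y <= z.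
Proof.
move=> m_ge1 zP; apply: ge_sup; last by move=> _ [[n a] _ <-]; exact: zP.
by eexists; exists (0%N, fun=> Ordinal m_ge1).
Qed.

(** This is the term of the empty word; it makes [orbit_dist] separate points. *)
Lemma orbit_dist_ge (R : realType) (K : set R) (m : nat) (f : 'I_m -> R -> R)
    (x y : R) :
  compact K -> (1 <= m)%N -> (forall i, set_fun K K (f i)) -> K x -> K y ->
  `|x - y| <= orbit_dist f x y.
Proof.
move=> Kc m_ge1 fK Kx Ky.
have := le_orbit_dist 0 (fun=> Ordinal m_ge1) Kc fK Kx Ky.
by apply: le_trans => /=; rewrite ler_peMl// weight_ge1.
Qed.

Lemma orbit_dist_metric (R : realType) (K : set R) (m : nat)
    (f : 'I_m -> R -> R) :
  compact K -> (1 <= m)%N -> (forall i, set_fun K K (f i)) ->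
  metric_on K (orbit_dist f).
Proof.
move=> Kc m_ge1 fK.
have d_ge x y : K x -> K y -> `|x - y| <= orbit_dist f x y.
  exact: orbit_dist_ge.
split=> [x y Kx Ky|x y Kx Ky|x y Kx Ky|x y z Kx Ky Kz].
- exact: le_trans (d_ge _ _ Kx Ky).
- split=> [dxy|<-].
    by apply/eqP; rewrite -subr_eq0 -normr_le0 -dxy d_ge.
  apply/eqP; rewrite eq_le (le_trans _ (d_ge _ _ Kx Kx))// andbT.
  by apply: orbit_dist_le => // n a; rewrite subrr normr0 mulr0.
- by congr sup; apply: eq_imagel => p _; rewrite distrC.
- apply: orbit_dist_le => // n a.
  apply: le_trans (lerD (le_orbit_dist n a Kc fK Kx Ky)
                        (le_orbit_dist n a Kc fK Ky Kz)).
  rewrite -mulrDr ler_wpM2l ?ler_distD//.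
  exact: le_trans (weight_ge1 R n).
Qed.

(** The neighbourhood is uniform in [a] because there are finitely many words of length [n]: the
    induction splits off the innermost letter and intersects over its [m] values. *)
Lemma comp_prefix_equicontinuous (R : realType) (K : set R) (m : nat)
    (f : 'I_m -> R -> R) (n : nat) (x e : R) :
  (forall i, set_fun K K (f i)) -> (forall i, {within K, continuous (f i)}) ->
  K x -> 0 < e ->
  \forall z \near within K (nbhs x),
    forall a, `|comp_prefix f a n x - comp_prefix f a n z| <= e.
Proof.
move=> fK fc Kx e_gt0; elim: n x Kx => [|n IHn] x Kx /=.
  have /cvgrPdist_le/(_ _ e_gt0) : z @[z --> x] --> x by exact: cvg_id.
  by rewrite near_withinE; apply: filterS.
have : \forall z \near within K (nbhs x), forall i, forall a,
    `|comp_prefix f a n (f i x) - comp_prefix f a n (f i z)| <= e.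
  apply: filter_forall => i.
  exact: (cvg_within_set_fun (fc i) (fK i) Kx (IHn _ (fK i _ Kx))).
by apply: filterS => z zP a; exact: zP.
Qed.

(** Words of length at least [N] are handled by uniform shrinking, the finitely many shorter lengths
    by equicontinuity. The bound [e / 2] absorbs the weight, at most 2. *)
Lemma near_orbit_dist (R : realType) (K : set R) (m : nat)
    (f : 'I_m -> R -> R) (x e : R) :
  (1 <= m)%N -> (forall i, set_fun K K (f i)) ->
  (forall i, {within K, continuous (f i)}) -> uniformly_shrinking K f ->
  K x -> 0 < e ->
  \forall z \near within K (nbhs x), orbit_dist f x z <= e.
Proof.
move=> m_ge1 fK fc fU Kx e_gt0; have e2_gt0 : 0 < e / 2 by rewrite divr_gt0.
have [N fN] := fU _ e2_gt0.
have Kz : \forall z \near within K (nbhs x), K z by exact: withinT.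
have nz : \forall z \near within K (nbhs x), forall (n : 'I_N) a,
    `|comp_prefix f a n x - comp_prefix f a n z| <= e / 2.
  by apply: filter_forall => n; exact: comp_prefix_equicontinuous.
apply: filterS2 Kz nz => z Kz zP; apply: orbit_dist_le => // n a.
rewrite -(divfK (_ : 2 != 0) e)// mulrC; apply: ler_pM => //.
- exact: le_trans (weight_ge1 R n).
- by have [nN|Nn] := ltnP n N; [exact: (zP (Ordinal nN))|exact: fN].
- exact: weight_le2.
Qed.

Lemma orbit_dist_continuous (R : realType) (K : set R) (m : nat)
    (f : 'I_m -> R -> R) :
  compact K -> (1 <= m)%N -> (forall i, set_fun K K (f i)) ->
  (forall i, {within K, continuous (f i)}) -> uniformly_shrinking K f ->
  continuous_metric_on K (orbit_dist f).
Proof.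
move=> Kc m_ge1 fK fc fU.
have dm := orbit_dist_metric Kc m_ge1 fK; split=> //.
apply/subspace_continuousP => -[x y] [/= Kx Ky].
apply/cvgrPdist_le => e e_gt0; have e2_gt0 : 0 < e / 2 by rewrite divr_gt0.
have cfst : {within K `*` K, continuous (@fst R R)}.
  by apply: continuous_subspaceT => -[? ?]; exact: cvg_fst.
have csnd : {within K `*` K, continuous (@snd R R)}.
  by apply: continuous_subspaceT => -[? ?]; exact: cvg_snd.
have Kxy : (K `*` K) (x, y) by [].
have fstK : set_fun (K `*` K) K (@fst R R) by move=> ? [].
have sndK : set_fun (K `*` K) K (@snd R R) by move=> ? [].
have dx := cvg_within_set_fun cfst fstK Kxy
  (near_orbit_dist m_ge1 fK fc fU Kx e2_gt0).
have dy := cvg_within_set_fun csnd sndK Kxy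
  (near_orbit_dist m_ge1 fK fc fU Ky e2_gt0).
have Kp : \forall p \near within (K `*` K) (nbhs (x, y)), (K `*` K) p.
  exact: withinT.
apply: filterS3 Kp dx dy => -[s t] [/= Ks Kt] dxs dyt.
(* The distances of [(x, y)] and of [(s, t)] differ by at most [d x s + d y t]. *)
have tri := Defs.metric_triangle dm; have sym := Defs.metric_sym dm.
have := tri _ _ _ Kx Ks Ky; have := tri _ _ _ Ks Kt Ky.
have := tri _ _ _ Ks Kx Kt; have := tri _ _ _ Kx Ky Kt.
rewrite (sym t y)// (sym s x)// ler_norml /from_subspace /= => *; apply/andP; split; lra.
Qed.

(* Far along the sequence the terms are at most half of [|x - y|], and before
   that the increase of the weights gains a factor [q < 1]. *)
Lemma orbit_dist_contracting (R : realType) (K : set R) (m : nat)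
    (f : 'I_m -> R -> R) (i : 'I_m) :
  compact K -> (1 <= m)%N -> (forall i, set_fun K K (f i)) ->
  uniformly_shrinking K f -> contracting_on K (orbit_dist f) (f i).
Proof.
move=> Kc m_ge1 fK fU x y Kx Ky xy.
have xy_gt0 : 0 < `|x - y| by rewrite normr_gt0 subr_eq0; exact/eqP.
have dxy := orbit_dist_ge Kc m_ge1 fK Kx Ky.
have e_gt0 : 0 < `|x - y| / 4 by rewrite divr_gt0.
have [N fN] := fU _ e_gt0; have [q [q_gt0 q_lt1 qP]] := weight_ratio R N.
(* One factor below 1 covers both ranges: [q] for [n < N], and 1/2 beyond, as weight 2 times
   [|x - y| / 4] is half of [|x - y|]. *)
apply: (@le_lt_trans _ _ (Num.max q (1 / 2) * orbit_dist f x y)); last first.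
  rewrite gtr_pMl; last exact: lt_le_trans dxy.
  by rewrite gt_max q_lt1; lra.
apply: orbit_dist_le => // n a; have [nN|Nn] := ltnP n N.
  (* The word formed by the first [n] letters of [a] followed by [i]. *)
  pose b j := if j == n then i else a j.
  have bE z : comp_prefix f a n (f i z) = comp_prefix f b n.+1 z.
    rewrite /= {2}/b eqxx; congr (_ _); apply: eq_comp_prefix => j jn.
    by rewrite /b ltn_eqF.
  rewrite !bE; apply: (@le_trans _ _ (q * orbit_dist f x y)).
    apply: le_trans (ler_wpM2l (ltW q_gt0) (le_orbit_dist n.+1 b Kc fK Kx Ky)).
    by rewrite mulrA ler_wpM2r// qP.
  rewrite ler_wpM2r ?le_max ?lexx//.
  exact: le_trans dxy.
apply: (@le_trans _ _ (1 / 2 * orbit_dist f x y)); last first.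
  rewrite ler_wpM2r ?le_max ?lexx ?orbT//.
  exact: le_trans dxy.
have := fN n a _ _ Nn (fK i _ Kx) (fK i _ Ky).
have := weight_le2 R n; have := weight_ge1 R n; nra.
Qed.

(** Every composition preserves the chain [x <= s <= t <= y], so the inequality holds term by
    term. *)
Lemma orbit_dist_order_compatible (R : realType) (K : set R) (m : nat)
    (f : 'I_m -> R -> R) :
  compact K -> (1 <= m)%N -> (forall i, set_fun K K (f i)) ->
  (forall i x y, K x -> K y -> x <= y -> f i x <= f i y) ->
  order_compatible_on K (orbit_dist f).
Proof.
move=> Kc m_ge1 fK f_homo x y s t Kx Ky Ks Kt xs st ty.
have F_homo n a u v : K u -> K v -> u <= v ->
    comp_prefix f a n u <= comp_prefix f a n v.
  elim: n u v => //= n IHn u v Ku Kv uv.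
  by apply: IHn; [exact: fK|exact: fK|exact: f_homo].
apply: orbit_dist_le => // n a.
apply: le_trans (le_orbit_dist n a Kc fK Kx Ky).
rewrite ler_wpM2l//; first exact: le_trans (weight_ge1 R n).
have Fxs := F_homo n a _ _ Kx Ks xs; have Fst := F_homo n a _ _ Ks Kt st.
have Fty := F_homo n a _ _ Kt Ky ty.
by rewrite !(ler0_norm (_ : _ - _ <= 0)); lra.
Qed.

(** * The equivalences, through uniform shrinking *)

Theorem theorem5p6 (R : realType) (K : set R) (m : nat)
    (f : 'I_m -> R -> R)
    (Kcompact : compact K) (m_ge1 : (1 <= m)%N)
    (fK : forall i, set_fun K K (f i))
    (fcont : forall i, {within K, continuous (f i)}) :
  let condA := forall a : nat -> 'I_m,
    diam (comp_prefix f a n @` K) @[n --> \oo] --> (0 : R) in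
  let condB := exists d : R -> R -> R,
    continuous_metric_on K d /\ (forall i, contracting_on K d (f i)) in
  let condC := exists d : R -> R -> R,
    [/\ continuous_metric_on K d, (forall i, contracting_on K d (f i))
      & order_compatible_on K d] in
  (condA <-> condB) /\
  ((forall i x y, K x -> K y -> x <= y -> f i x <= f i y) ->
   (condA <-> condC) /\ (condB <-> condC)).
Proof.
move=> condA condB condC.
have BU : condB -> uniformly_shrinking K f.
  by move=> [d [dc df]]; exact: contracting_uniformly_shrinking dc df.
have UA : uniformly_shrinking K f -> condA.
  by move=> fU a; exact: uniformly_shrinking_diam.
have AU : condA -> uniformly_shrinking K f.
  exact: diam_uniformly_shrinking.
have AB : condA -> condB.
  move=> /AU fU; exists (orbit_dist f).
  by split=> [|i]; [exact: orbit_dist_continuous|exact: orbit_dist_contracting].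
split; first by split=> [//|/BU/UA].
move=> f_homo.
have AC : condA -> condC.
  move=> /AU fU; exists (orbit_dist f); split=> [|i|].
  - exact: orbit_dist_continuous.
  - exact: orbit_dist_contracting.
  - exact: orbit_dist_order_compatible.
have CB : condC -> condB by move=> [d [dc df _]]; exists d.
split; first by split=> [|/CB/BU/UA].
by split=> [/BU/UA/AC|].
Qed.
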